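(* Let $A$ be a nonempty set (of arbitrary cardinality) and consider the monoid $\mathbb{N}=\{0,1,2,\dots\}$ with the usual sum. For every shift space $\Lambda\subset A^{\mathbb{N}}$ there exists a directed labeled graph $\mathcal{G}$ (possibly infinite) with labels in $A$ such that $\Lambda=X_{\mathcal{G}}$.
   Context: $A$ carries the discrete topology and $A^{\mathbb{N}}$ the product topology. A shift space $\Lambda\subset A^{\mathbb{N}}$ is a set of the form $\{x\in A^{\mathbb{N}}: (x_{g+i})_{i\in N}\notin F\ \text{for all } g\in\mathbb{N}\text{ and all finite nonempty } N\subset\mathbb{N}\}$, where $F$ is a set of patterns (elements of $A^N$ with $N\subset\mathbb{N}$ finite nonempty); equivalently, $\Lambda$ is closed and invariant under the shift map. A directed labeled graph $\mathcal{G}=(\mathcal{V},\mathcal{E},s,r,\mathcal{L})$ consists of nonempty sets $\mathcal{V}$ (vertices) and $\mathcal{E}$ (edges), maps $s,r:\mathcal{E}\to\mathcal{V}$ (source and range) and a label map $\mathcal{L}:\mathcal{E}\to A$. It generates $$X_{\mathcal{G}}:=\{(\mathcal{L}(e_i))_{i\in\mathbb{N}}:\ (e_i)_{i\in\mathbb{N}}\in\mathcal{E}^{\mathbb{N}},\ s(e_{i+1})=r(e_i)\ \forall i\in\mathbb{N}\}.$$ *)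

(* Defs.v *)
From mathcomp Require Import all_boot.
From mathcomp Require Import finmap.
From mathcomp Require Import boolp classical_sets.

Set Implicit Arguments.
Unset Strict Implicit.
Unset Printing Implicit Defensive.

Local Open Scope fset_scope.
Local Open Scope classical_set_scope.

Record pattern (A : Type) := Pattern {
  pattern_dom : {fset nat};
  pattern_dom_neq0 : pattern_dom != fset0;
  pattern_val : {ffun pattern_dom -> A} }.

(* The pattern (x_(g+i))_(i in N) read off x at position g. *)
Definition pattern_at (A : Type) (x : nat -> A) (g : nat)
    (N : {fset nat}) (N_neq0 : N != fset0) : pattern A :=
  Pattern N_neq0 [ffun i : N => x (g + fsval i)%N].

Definition avoiding (A : Type) (F : set (pattern A)) : set (nat -> A) :=
  [set x | forall (g : nat) (N : {fset nat}) (N_neq0 : N != fset0),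
             ~ F (pattern_at x g N_neq0)].

Definition shift_space (A : Type) (L : set (nat -> A)) : Prop :=
  exists F : set (pattern A), L = avoiding F.

Record labeled_graph (A : Type) := LabeledGraph {
  vertex : Type;
  edge : Type;
  vertex_inhabited : inhabited vertex;
  edge_inhabited : inhabited edge;
  source : edge -> vertex;
  range_of : edge -> vertex;
  label : edge -> A }.

Definition graph_shift (A : Type) (G : labeled_graph A) : set (nat -> A) :=
  [set x | exists2 e : nat -> edge G,
             (forall i : nat, source (e i.+1) = range_of (e i)) &
             x = (fun i : nat => label (e i))].

(* Main.v *)
(** Take as edges the points [x] of the shift space, [x] going from the vertex [x] to the vertex
    [shift x] with label [x 0]. Consecutive edges of a path are then successive shifts of its first
    edge, so the label sequence of a path is its first edge. Only shift invariance is used; since a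
    graph needs an edge even when the shift space is empty, an extra edge into a dead end is added. *)
Require Import Defs.
From mathcomp Require Import all_boot.
From mathcomp Require Import finmap.
From mathcomp Require Import boolp classical_sets.

Definition shift {A : Type} (x : nat -> A) : nat -> A := fun i => x i.+1.

Lemma iter_shift {A : Type} (x : nat -> A) (n i : nat) :
  iter n shift x i = x (n + i).
Proof. by elim: n i => [|n IHn] i //=; rewrite /shift IHn addnS. Qed.

Lemma shift_space_shift {A : Type} {L : set (nat -> A)} {x : nat -> A} :
  shift_space L -> L x -> L (shift x).
(* The pattern of [shift x] at [g] is, by conversion, that of [x] at [g.+1]. *)
Proof. by case=> F -> Fx g N N_neq0; apply: (Fx g.+1 N N_neq0). Qed.

Lemma shift_space_iter_shift {A : Type} {L : set (nat -> A)} {x : nat -> A} (n : nat) :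
  shift_space L -> L x -> L (iter n shift x).
Proof. by move=> hL Lx; elim: n => //= n; apply: shift_space_shift. Qed.

(* The edge [None] leads from [inr false] to the dead end [inr true]. *)
Definition follower_graph {A : Type} (a : A) (L : set (nat -> A)) : labeled_graph A :=
  @LabeledGraph A ((nat -> A) + bool) (option {x : nat -> A | L x})
    (inhabits (inr true)) (inhabits None)
    (fun e => if e is Some x then inl (sval x) else inr false)
    (fun e => if e is Some x then inl (shift (sval x)) else inr true)
    (fun e => if e is Some x then sval x 0 else a).

(** Tracking sources instead of edges avoids comparing membership proofs. *)
Lemma follower_graph_path {A : Type} {a : A} {L : set (nat -> A)}
    {e : nat -> edge (follower_graph a L)} :
    (forall i, source (e i.+1) = range_of (e i)) ->
  exists2 x, L x & forall i, source (e i) = inl (iter i shift x).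
Proof.
move=> path_e.
(* No edge leaves [inr true], so a path cannot continue after [None]. *)
have [x0 e0] : exists x, e 0 = Some x.
  by have := path_e 0; case: (e 0) (e 1) => [x|] [y|] //= _; exists x.
exists (sval x0); first exact: svalP x0.
elim=> [|i IHi]; first by rewrite e0.
(* By induction [e i] starts at an [inl] vertex, which excludes [None]. *)
by rewrite path_e; move: IHi; case: (e i) => //= y [->].
Qed.

Lemma graph_shift_follower_graph {A : Type} (a : A) (L : set (nat -> A)) :
  shift_space L -> graph_shift (follower_graph a L) = L.
Proof.
move=> hL; apply/seteqP; split=> [_ [e path_e ->]|x Lx].
  have [x Lx src_e] := follower_graph_path path_e.
  suff -> : (fun i => label (e i)) = x by [].
  apply/funext => i.
  by have := src_e i; case: (e i) => //= y [->]; rewrite iter_shift addn0.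
exists (fun i => Some (exist _ _ (shift_space_iter_shift i hL Lx))) => //=.
by apply/funext => i; rewrite iter_shift addn0.
Qed.

Theorem theorem6p1 (A : Type) (A_inhabited : inhabited A)
    (L : set (nat -> A)) (hL : shift_space L) :
  exists G : labeled_graph A, L = graph_shift G.
Proof.
case: A_inhabited => a; exists (follower_graph a L).
by rewrite graph_shift_follower_graph.
Qed.
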